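(* For every infinite compact metric space $(X,d)$, the space $(\mathbb{N},\varrho_X)$ is isometric to a dense subset of $X$.
   Context: Here $\mathbb{N}=\{0,1,2,\ldots\}$, and for an infinite compact metric space $(X,d)$ the metric $\varrho_X$ on $\mathbb{N}$ is constructed recursively as follows. On $\{0\}$ it is the trivial metric. Suppose that for some $n\in\mathbb{N}$ the metric $\varrho_X$ has been defined on $\{0,\ldots,n\}$ so that $(\{0,\ldots,n\},\varrho_X)$ embeds isometrically into $X$. Put $$F_n:=\{(x_0,\ldots,x_n)\in X^{n+1}: d(x_j,x_k)=\varrho_X(j,k),\ j,k=0,\ldots,n\},$$ $$f_n\colon F_n\times X\to\mathbb{R},\quad f_n(x_0,\ldots,x_n;x):=\min(d(x_0,x),\ldots,d(x_n,x)),$$ $$A_0^{n+1}:=\{(x;y)\in F_n\times X: f_n(x;y)=\max f_n(F_n\times X)\},$$ and for $j=1,\ldots,n+1$ inductively $$A_j^{n+1}:=\bigl\{(y_0,\ldots,y_n;y)\in A_{j-1}^{n+1}: d(y_{j-1},y)=\max\{d(x_{j-1},x): (x_0,\ldots,x_n;x)\in A_{j-1}^{n+1}\}\bigr\}.$$ All these sets are nonempty. Take any $(x_0,\ldots,x_n;x_{n+1})\in A_{n+1}^{n+1}$ and put $\varrho_X(j,n+1)=\varrho_X(n+1,j):=d(x_j,x_{n+1})$ for $j=0,\ldots,n+1$. This does not depend on the choice of the element of $A_{n+1}^{n+1}$ and yields a metric on $\{0,\ldots,n+1\}$ for which this set embeds isometrically into $X$. *)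

(* Defs.v *)
From HB Require Import structures.
From mathcomp Require Import all_boot all_order all_algebra.
From mathcomp Require Import all_classical all_reals all_analysis.

Set Implicit Arguments.
Unset Strict Implicit.
Unset Printing Implicit Defensive.

Import Order.TTheory GRing.Theory Num.Theory.
Local Open Scope classical_set_scope.
Local Open Scope ring_scope.

Definition is_max (R : realType) (S : set R) (m : R) : Prop :=
  S m /\ ubound S m.

(* An element (x_0, ..., x_n; x) of X^{n+1} * X. *)
Definition conf (X : Type) (n : nat) : Type := (('I_n.+1 -> X) * X)%type.

(* x_j for j <= n, and the last point x for j = n+1 (and any larger j). *)
Definition pt (X : Type) (n : nat) (p : conf X n) (j : nat) : X :=
  oapp p.1 p.2 (insub j).

(* In what follows [r] is a metric on {0, ..., n}; its values at other
   arguments are never used. *)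
Definition Fset (R : realType) (X : metricType R) (n : nat)
    (r : nat -> nat -> R) : set ('I_n.+1 -> X) :=
  [set x | forall j k : 'I_n.+1, mdist (x j) (x k) = r j k].

Definition fmin (R : realType) (X : metricType R) (n : nat)
    (p : conf X n) : R :=
  \big[Num.min/mdist (p.1 ord0) p.2]_(j < n.+1) mdist (p.1 j) p.2.

(* [Aset X n r j] is A_j^{n+1}. *)
Fixpoint Aset (R : realType) (X : metricType R) (n : nat)
    (r : nat -> nat -> R) (j : nat) : set (conf X n) :=
  match j with
  | 0 => [set p | (@Fset R X n r `*` [set: X]) p /\
           is_max [set fmin q | q in @Fset R X n r `*` [set: X]] (fmin p)]
  | i.+1 => [set p | @Aset R X n r i p /\
           is_max [set mdist (pt q i) q.2 | q in @Aset R X n r i]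
                  (mdist (pt p i) p.2)]
  end.

Arguments Aset {R} X n r j _.

Definition extend_metric (R : realType) (X : metricType R) (n : nat)
    (r : nat -> nat -> R) (p : conf X n) : nat -> nat -> R :=
  fun j k => if k == n.+1 then mdist (pt p j) p.2
             else if j == n.+1 then mdist (pt p k) p.2
             else r j k.

(* [rho_stage X n] is the metric on {0, ..., n} obtained after n steps. The
   choice is made among the metrics r' induced by the elements of
   A_{n+1}^{n+1}, so that no default point of X is needed; by
   [Aset_dist_unique] all of them agree on {0, ..., n+1}. *)
Fixpoint rho_stage (R : realType) (X : metricType R) (n : nat) :
    nat -> nat -> R :=
  match n with
  | 0 => fun _ _ => 0
  | m.+1 => let r := rho_stage X m in
      xget r [set extend_metric r p | p in Aset X m r m.+1]
  end.

Definition rho (R : realType) (X : metricType R) (j k : nat) : R :=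
  rho_stage X (maxn j k) j k.

Lemma Aset_dist_unique (R : realType) (X : metricType R) (n : nat)
    (r : nat -> nat -> R) (p q : conf X n) :
  Aset X n r n.+1 p -> Aset X n r n.+1 q ->
  forall j, (j <= n.+1)%N -> mdist (pt p j) p.2 = mdist (pt q j) q.2.
Proof.
have sub m : Aset X n r m.+1 `<=` Aset X n r m by move=> u [].
have anti m i : (i <= m)%N -> Aset X n r m `<=` Aset X n r i.
  elim: m => [|m IH]; first by rewrite leqn0 => /eqP ->.
  by rewrite leq_eqVlt => /predU1P[->//|im] u /sub; exact: IH.
move=> Ap Aq j; rewrite leq_eqVlt => /predU1P[->|jn].
  by rewrite /pt insubF ?ltnn //= !mdistxx.
have [_ [pv pu]] := anti _ _ jn _ Ap.
have [_ [qv qu]] := anti _ _ jn _ Aq.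
by apply/eqP; rewrite eq_le qu // pu.
Qed.

(* Main.v *)
(* Every finite stage (N restricted to {0, ..., n}, rho) embeds isometrically
   into X, so by compactness of X^N there is a single sequence phi realizing
   all of rho. The point n+1 maximizes the distance to the first n+1 points
   over all their isometric copies in X; hence, if some x stayed at distance
   at least e from the whole of phi, then phi would be an e-separated sequence,
   which a compact space does not contain. *)
Require Import Defs.
From HB Require Import structures.
From mathcomp Require Import all_boot all_order all_algebra.
From mathcomp Require Import all_classical all_reals all_analysis.

Set Implicit Arguments.
Unset Strict Implicit.

Import Order.TTheory GRing.Theory Num.Theory.
Import numFieldNormedType.Exports.
Local Open Scope classical_set_scope.
Local Open Scope ring_scope.

(** * Continuity, maximizers and separated sequences under compactness *)

Section topology.
Context {R : realType}.

(** Two triangle inequalities bound the variation of the distance by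
    [mdist (f t) (f s) + mdist (g t) (g s)]. *)
Lemma continuous_mdist {T : topologicalType} {X : metricType R} (f g : T -> X) :
  continuous f -> continuous g -> continuous (fun t => mdist (f t) (g t)).
Proof.
move=> cf cg t; apply/(@cvgrPdist_lt R R^o) => e e0.
have e2 : 0 < e / 2 by rewrite divr_gt0.
near=> s.
have fs : mdist (f t) (f s) < e / 2.
  by near: s; exact: (metricType_numDomainType.cvgr_dist_lt (cf t)).
have gs : mdist (g t) (g s) < e / 2.
  by near: s; exact: (metricType_numDomainType.cvgr_dist_lt (cg t)).
have fgs : mdist (f t) (f s) + mdist (g t) (g s) < e.
  by rewrite (splitr e) ltrD.
apply: le_lt_trans fgs; rewrite ler_norml; apply/andP; split.
  rewrite lerNl opprB lerBlDr.
  apply: (le_trans (metric_triangle _ (f t) _)).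
  rewrite (metric_sym (f s)) -addrA lerD2l addrC.
  exact: metric_triangle.
rewrite lerBlDr.
apply: (le_trans (metric_triangle _ (f s) _)).
rewrite -addrA lerD2l addrC (metric_sym (g t)).
exact: metric_triangle.
Unshelve. all: by end_near. Qed.

Lemma continuous_bigmin {T : topologicalType} {I : Type} (s : seq I)
    (f0 : T -> R) (f : I -> T -> R) :
  continuous f0 -> (forall i, continuous (f i)) ->
  continuous (fun t => \big[Num.min/f0 t]_(i <- s) f i t).
Proof.
move=> cf0 cf; elim: s => [|i s IHs].
  by under eq_fun do rewrite big_nil.
under eq_fun do rewrite big_cons.
by move=> t; apply: (@continuous_min R T (f i)); [exact: cf|exact: IHs].
Qed.

(** The maximum is attained at some [c], and the maximizers are [A] cut by the closed level set
    [f t = f c]. Since closedness survives, maximizations can be chained. *)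
Lemma argmax_closed_nonempty {T : topologicalType} (f : T -> R) (A : set T) :
  compact [set: T] -> continuous f -> closed A -> A !=set0 ->
  let B := [set t | A t /\ is_max [set f s | s in A] (f t)] in
  closed B /\ B !=set0.
Proof.
move=> cT cf cA A0 B.
have coA : compact A by exact: subclosed_compact cA cT _.
have [c Ac cmax] := compact_EVT_max A0 coA (continuous_subspaceT cf).
move/set_mem in Ac.
have Bc : B c.
  split=> //; split; first by exists c.
  by move=> _ [t At <-]; exact: cmax (mem_set At).
split; last by exists c.
suff -> : B = A `&` f @^-1` [set x | x = f c].
  by apply: closedI => //; apply: preimage_closed => //; exact: closed_eq.
apply/seteqP; split=> t [At].
  move=> [_ tmax]; split=> //=; apply/eqP; rewrite eq_le tmax ?andbT.
    by exact: cmax (mem_set At).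
  by exists c.
by move=> /= ft; split=> //; rewrite ft; case: Bc.
Qed.

Lemma compact_sequence_not_separated {X : metricType R} (phi : nat -> X) (e : R) :
  compact [set: X] -> 0 < e ->
  exists m n, (m < n)%N /\ mdist (phi m) (phi n) < e.
Proof.
move=> cX e0; have e2 : 0 < e / 2 by rewrite divr_gt0.
have [x [_ clx]] : [set: X] `&` cluster (phi @ \oo) !=set0.
  by apply: cX; exact: filterT.
(* Every tail of [phi] meets the ball of radius [e / 2] around the cluster point [x]; two such
   visits give terms closer than [e]. *)
have visit N : exists n, (N <= n)%N /\ mdist x (phi n) < e / 2.
  have [|y [[n /= Nn <-]]] :=
      clx (phi @` [set n | (N <= n)%N]) _ _ (nbhsx_ballx x _ e2).
    by exists N => // n /= Nn; exists n.
  by rewrite ballEmdist /= => xn; exists n.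
have [m [_ xm]] := visit 0%N.
have [n [mn xn]] := visit m.+1.
exists m, n; split=> //.
apply: (le_lt_trans (metric_triangle _ x _)).
by rewrite metric_sym (splitr e) ltrD.
Qed.

End topology.

(** * Configurations as images of sequences, and the sets A_j^{n+1} *)

Section stages.
Context {R : realType} {X : metricType R} (cX : compact [set: X]).

(* The configuration spaces X^{n+1} * X are all quotients of X^N, so that only
   one compact space is needed. *)
Definition seq_conf (n : nat) (u : {ptws nat -> X}) : conf X n :=
  (fun i : 'I_n.+1 => u i, u n.+1).

Lemma pt_seq_conf n u j : pt (seq_conf n u) j = u (minn j n.+1).
Proof.
rewrite /pt; case: insubP => [i ji <-|/=].
  by rewrite /= (minn_idPl (ltnW (ltn_ord i))).
by rewrite -leqNgt => /minn_idPr ->.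
Qed.

Lemma pt_last n (p : conf X n) : pt p n.+1 = p.2.
Proof. by rewrite /pt insubF // ltnn. Qed.

Lemma pt_ord n (p : conf X n) (i : 'I_n.+1) : pt p i = p.1 i.
Proof. by rewrite /pt valK. Qed.

Lemma pt_seq_confK n (p : conf X n) : seq_conf n (pt p) = p.
Proof.
case: p => x y; congr pair; last exact: pt_last (x, y).
by apply/funext => i; exact: pt_ord (x, y) i.
Qed.

(** [seq_conf n] is onto, with right inverse [pt], so maximizing over configurations amounts to
    maximizing over sequences. *)
Lemma image_seq_conf n (g : conf X n -> R) (S : set (conf X n)) :
  [set g q | q in S] = [set g (seq_conf n u) | u in seq_conf n @^-1` S].
Proof.
apply/seteqP; split=> _ [q Sq <-].
  by exists (pt q); rewrite /= pt_seq_confK.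
by exists (seq_conf n q).
Qed.

Lemma compact_sequences : compact [set: {ptws nat -> X}].
Proof.
have := @tychonoff nat (fun=> X) (fun=> [set: X]) (fun=> cX).
by congr compact; apply/seteqP.
Qed.

Lemma continuous_mdist_coord j k :
  continuous (fun u : {ptws nat -> X} => mdist (u j) (u k)).
Proof.
by apply: continuous_mdist; exact: (@proj_continuous nat (fun=> X)).
Qed.

Lemma closed_mdist_coord j k c :
  closed [set u : {ptws nat -> X} | mdist (u j) (u k) = c].
Proof.
apply: (@preimage_closed _ R (fun u : {ptws nat -> X} => mdist (u j) (u k))
  [set x | x = c]); last exact: closed_eq.
by move=> u _; exact: continuous_mdist_coord.
Qed.

Lemma closed_isometric_coords n (r : nat -> nat -> R) :
  closed [set u : {ptws nat -> X} |
    forall j k : 'I_n.+1, mdist (u j) (u k) = r j k].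
Proof.
have -> : [set u : {ptws nat -> X} |
      forall j k : 'I_n.+1, mdist (u j) (u k) = r j k] =
    \bigcap_(jk in [set: 'I_n.+1 * 'I_n.+1])
      [set u : {ptws nat -> X} | mdist (u jk.1) (u jk.2) = r jk.1 jk.2].
  apply/seteqP; split=> u H; first by move=> [j k] _; exact: H.
  by move=> j k; exact: (H (j, k)).
by apply: closed_bigI => jk _; exact: closed_mdist_coord.
Qed.

(** Induction on [j]: each set consists of the maximizers of a continuous function on the previous
    one, pulled back to the compact space X^N. *)
Lemma Aset_closed_nonempty n r j : @Fset R X n r !=set0 ->
  closed (seq_conf n @^-1` Aset X n r j) /\ Aset X n r j !=set0.
Proof.
move=> [x0 Fx0].
suff [cA [u Au]] : closed (seq_conf n @^-1` Aset X n r j) /\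
    seq_conf n @^-1` Aset X n r j !=set0 by split=> //; exists (seq_conf n u).
elim: j => [|j [cA A0]] /=; rewrite image_seq_conf.
  apply: (@argmax_closed_nonempty _ _ (fun u => fmin (seq_conf n u))
    (seq_conf n @^-1` (@Fset R X n r `*` [set: X]))).
  - exact: compact_sequences.
  - by apply: continuous_bigmin => [|i]; exact: continuous_mdist_coord.
  - rewrite (_ : _ @^-1` _ = [set u : {ptws nat -> X} |
      forall j k : 'I_n.+1, mdist (u j) (u k) = r j k]).
      exact: closed_isometric_coords.
    by apply/seteqP; split=> u => [[]|].
  - by exists (pt (x0, x0 ord0)); rewrite /preimage /mkset pt_seq_confK.
apply: (@argmax_closed_nonempty _ _
  (fun u => mdist (pt (seq_conf n u) j) (seq_conf n u).2)) => //.
  exact: compact_sequences.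
(* [pt] returns the last point for every index beyond [n], whence the truncation [minn j n.+1]. *)
rewrite (_ : (fun _ => _) = fun u => mdist (u (minn j n.+1)) (u n.+1)).
  exact: continuous_mdist_coord.
by apply/funext => u; rewrite pt_seq_conf.
Qed.

(** * The recursion for [rho] and its realization in X *)

Lemma Aset_sub0 n r j : Aset X n r j `<=` Aset X n r 0.
Proof. by elim: j => // j IHj p [/IHj]. Qed.

(** Nonemptiness of A_{n+1}^{n+1} rules out the default value of [xget]. *)
Lemma rho_stageS n : @Fset R X n (rho_stage X n) !=set0 ->
  exists2 p, Aset X n (rho_stage X n) n.+1 p &
    rho_stage X n.+1 = extend_metric (rho_stage X n) p.
Proof.
move=> /Aset_closed_nonempty -/(_ n.+1)[_ [p Ap]] /=.
case: xgetP => [_ _ [q Aq <-]|/(_ (extend_metric (rho_stage X n) p))].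
  by exists q.
by case; exists p.
Qed.

(** An extension step changes only entries involving the new index, and the default of [xget]
    changes nothing. *)
Lemma rho_stage_stable m n j k : (j <= m)%N -> (k <= m)%N -> (m <= n)%N ->
  rho_stage X n j k = rho_stage X m j k.
Proof.
move=> jm km /subnKC <-; elim: (n - m)%N => [|d IHd]; first by rewrite addn0.
rewrite addnS -IHd /=; case: xgetP => // _ _ [p _ <-].
by rewrite /extend_metric !ltn_eqF // ltnS (leq_trans _ (leq_addr _ _)).
Qed.

Lemma rho_stageE n j k : (j <= n)%N -> (k <= n)%N ->
  rho_stage X n j k = rho X j k.
Proof.
move=> jn kn; rewrite /rho (rho_stage_stable (m := maxn j k)) //.
- exact: leq_maxl.
- exact: leq_maxr.
- by rewrite geq_max jn.
Qed.

Lemma Fset_extend n r (p : conf X n) : @Fset R X n r p.1 ->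
  @Fset R X n.+1 (extend_metric r p) (fun i : 'I_n.+2 => pt p i).
Proof.
move=> Fp j k; rewrite /extend_metric.
case: eqP => [->|/eqP kn]; first by rewrite pt_last.
case: eqP => [->|/eqP jn]; first by rewrite pt_last metric_sym.
have lt_ord (i : 'I_n.+2) : i != n.+1 :> nat -> (i < n.+1)%N.
  by move=> i_n; rewrite ltn_neqAle i_n -ltnS ltn_ord.
have := Fp (Ordinal (lt_ord _ jn)) (Ordinal (lt_ord _ kn)).
by rewrite -!pt_ord.
Qed.

Lemma Fset_rho_stage_nonempty n : [set: X] !=set0 ->
  @Fset R X n (rho_stage X n) !=set0.
Proof.
move=> [x _]; elim: n => [|n IHn].
  by exists (fun=> x) => j k; rewrite mdistxx.
have [p Ap ->] := rho_stageS IHn.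
exists (fun i : 'I_n.+2 => pt p i); apply: Fset_extend.
by have [[]] := Aset_sub0 Ap.
Qed.

Lemma rho_realized : [set: X] !=set0 ->
  exists phi : nat -> X, forall j k, mdist (phi j) (phi k) = rho X j k.
Proof.
move=> X0.
have stage n : exists u : {ptws nat -> X},
    forall j k : 'I_n.+1, mdist (u j) (u k) = rho X j k.
  have [x Fx] := Fset_rho_stage_nonempty n X0.
  exists (pt (x, x ord0)) => j k.
  by rewrite !pt_ord Fx rho_stageE // -ltnS.
have [u uP] := choice stage.
have [phi [_ clphi]] : [set: {ptws nat -> X}] `&` cluster (u @ \oo) !=set0.
  by apply: compact_sequences; exact: filterT.
(* The equation for [j], [k] is a closed condition that holds for [u n] once [n >= maxn j k], so it
   passes to the cluster point. *)
exists phi => j k; apply: (closed_mdist_coord (j := j) (k := k)).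
move=> B /clphi; apply; exists (maxn j k) => // n /=.
rewrite geq_max => /andP[jn kn] /=.
by have := uP n (Ordinal (jn : (j < n.+1)%N)) (Ordinal (kn : (k < n.+1)%N)).
Qed.

Lemma fmin_le n (p : conf X n) (i : 'I_n.+1) : fmin p <= mdist (p.1 i) p.2.
Proof. exact: bigmin_le_cond. Qed.

(** The configuration (phi 0, ..., phi n; x) competes in the maximization of [fmin] with value at
    least [e]; hence the maximum, and with it every distance to the new point, is at least [e]. *)
Lemma le_rho_next n (phi : nat -> X) (x : X) (e : R) :
  (forall j k, mdist (phi j) (phi k) = rho X j k) ->
  (forall j, (j <= n)%N -> e <= mdist (phi j) x) ->
  forall j, (j <= n)%N -> e <= rho X j n.+1.
Proof.
move=> phiP xfar j jn.
have F0 : @Fset R X n (rho_stage X n) (fun i : 'I_n.+1 => phi i).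
  by move=> i k; rewrite phiP rho_stageE // -ltnS.
have [p Ap rhoE] := rho_stageS (ex_intro _ _ F0).
have [_ [_ pmax]] := Aset_sub0 Ap.
rewrite -(@rho_stageE n.+1) // ?(leq_trans jn) // rhoE /extend_metric eqxx.
rewrite (_ : j = Ordinal (jn : (j < n.+1)%N)) // pt_ord.
apply: le_trans (fmin_le _ _).
apply: (@le_trans _ _ (fmin (fun i : 'I_n.+1 => phi i, x))).
  by apply/bigmin_geP; split=> [|i _] /=; apply: xfar => //; rewrite -ltnS.
by apply: pmax; exists (fun i : 'I_n.+1 => phi i, x).
Qed.

End stages.

Theorem proposition6p1 (R : realType) (X : metricType R)
    (cX : compact [set: X]) (iX : infinite_set [set: X]) :
  exists D : set X, dense D /\
    exists phi : nat -> X, set_bij [set: nat] D phi /\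
      forall j k : nat, mdist (phi j) (phi k) = rho X j k.
Proof.
have [phi phiP] := rho_realized cX (infinite_setN0 iX).
exists (range phi); split; last first.
  exists phi; split=> //; split=> //.
  (* Injectivity: as X is infinite, some [x] avoids phi 0, ..., phi n, and its least distance to
     them bounds [rho X j n.+1] from below. *)
  have phi_lt j k : (j < k)%N -> phi j != phi k.
    case: k => // n; rewrite ltnS => jn.
    have [x xnew] : exists x, forall i, (i <= n)%N -> phi i != x.
      apply: contrapT => /forallNP all_hit; apply: iX.
      apply: (@sub_finite_set _ _ (phi @` `I_n.+1)).
        move=> x _; have /existsNP[i] := all_hit x.
        by move=> /not_implyP[i_n /negP]; rewrite negbK => /eqP <-; exists i.
      exact/finite_image/finite_II.
    (* Any positive default would do in place of 1: it keeps [e] positive and below each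
       distance. *)
    pose e := \big[Num.min/1%R]_(i < n.+1) mdist (phi i) x.
    have e0 : 0 < e.
      apply/bigmin_gtP; split=> // i _.
      by rewrite mdist_gt0 xnew // -ltnS.
    rewrite -mdist_gt0 phiP (lt_le_trans e0) //.
    apply: (le_rho_next cX phiP (x := x)) jn => i i_n.
    exact: (@bigmin_le_cond _ _ _ _ (Ordinal (i_n : (i < n.+1)%N))).
  move=> j k _ _ jk; case: (ltngtP j k) => // /phi_lt /eqP //.
  by rewrite jk.
move=> O [x Ox] oO; apply: contrapT => O_miss.
have /nbhs_ballP[e /= e0 eO] := open_nbhs_nbhs (conj oO Ox).
have xfar j : e <= mdist (phi j) x.
  rewrite leNgt; apply/negP => jx; apply: O_miss; exists (phi j); split.
    by apply: eO; rewrite ballEmdist /= metric_sym.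
  by exists j.
(* The larger index of a close pair is a successor [n.+1], so [m <= n] and [le_rho_next] gives the
   contradiction. *)
have [m [[|n] [mn]]] := compact_sequence_not_separated phi cX e0; first by [].
by rewrite phiP ltNge (le_rho_next cX phiP (x := x) (n := n)).
Qed.
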